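(* Let $X$ be a hereditarily indecomposable continuum. Then $Ab(X)\leq 1$, and $Ab(X)=0$ if and only if $X$ is a singleton.
   Context: All spaces are Hausdorff, and subsets carry the subspace topology. A continuum is a compact, connected, Hausdorff space. A metric (i.e. metrizable) continuum $K$ is indecomposable if it cannot be written as the union of two proper subcontinua; it is hereditarily indecomposable if every subcontinuum of $K$ is also indecomposable. For a space $Y$ and points $x,z\in Y$, $\mathcal{C}(x,z,Y)$ denotes the collection of open connected subsets of $Y$ containing both $x$ and $z$. $cl_Y$ and $\partial_Y$ denote closure and boundary in $Y$. Line of sight: let $Y$ be a nonempty Hausdorff space, $x,z\in Y$ distinct points, and $K\subseteq Y\setminus\{z\}$ a subspace containing $x$. A continuum $C\subseteq Y$ containing $x$ and $z$ is a line of sight (in $Y$, with respect to $K$) from $z$ to $x$ if: (i) $\mathcal{C}(x,z,Y)$ contains a neighborhood basis for $C$, i.e. every open subset of $Y$ containing $C$ contains an element of $\mathcal{C}(x,z,Y)$ that contains $C$; and (ii) for every $U\subseteq K$ open in $K$ with $x\in U$ there is $V_U\in\mathcal{C}(x,z,Y)$ with $C\subseteq V_U$ and $V_U\cap K\subseteq cl_Y(V_U)\cap K\subseteq U$. Abbott dimension: let $X$ be a nonempty Hausdorff space. Let $X_0$ be the power set of $X$. Given $X_n$ ($n\geq 0$), let $X_{n+1}$ be the collection of all $Y\subseteq X$ for which there is a nonempty $K\in X_n$ such that (1) $K\subseteq Y$; and (2) there is a point $z\in Y\setminus K$ such that for every $x\in K$ there is a line of sight $W_{z,x}\subseteq Y$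 (in $Y$, with respect to $K$) from $z$ to $x$ with the following property: there is $V\in\mathcal{C}(x,z,Y)$ containing $W_{z,x}$ such that whenever $V'\in\mathcal{C}(x,z,Y)$ satisfies $W_{z,x}\subseteq V'\subseteq V$, there is $D\subseteq\partial_Y(V')$ with $D\in X_n$. Then $Ab(X)$ is the greatest $n$ with $X_n\neq\emptyset$, and $Ab(X)=\infty$ if $X_n\neq\emptyset$ for all $n$. Also $Ab(\emptyset)=-1$. *)

(* Defs.v *)
From HB Require Import structures.
From mathcomp Require Import all_boot all_order all_algebra.
From mathcomp Require Import all_classical all_reals.
From mathcomp Require Import topology.

Set Implicit Arguments.
Unset Strict Implicit.
Unset Printing Implicit Defensive.

Import Order.TTheory GRing.Theory Num.Theory.

Local Open Scope classical_set_scope.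
Local Open Scope ring_scope.

(* All spaces below are subsets Y of an ambient space X, assumed Hausdorff in
   the theorem, and carry the subspace topology.  In the library type
   [subspace Y], which has the same carrier as X, the points outside Y are
   isolated; for subsets of Y its open sets and closures are the relative
   ones. *)

Section Relative.
Variables (X : topologicalType) (Y : set X).

Definition open_in (U : set X) : Prop :=
  U `<=` Y /\ open (U : set (subspace Y)).

Definition closure_in (A : set X) : set X :=
  closure (A : set (subspace Y)).

Definition boundary_in (A : set X) : set X :=
  closure_in A `&` closure_in (Y `\` A).

Lemma open_inP (U : set X) :
  open_in U <-> exists2 O : set X, open O & U = Y `&` O.
Proof.
split=> [[UY /open_subspaceP[O oO OU]]|[O oO ->]].
  by exists O => //; rewrite setIC OU; apply/esym/setIidPl.
split; first exact: subIsetl.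
by apply/open_subspaceP; exists O => //; rewrite setIAC setIid setIC.
Qed.

Lemma closure_inE (A : set X) : A `<=` Y -> closure_in A = closure A `&` Y.
Proof. exact: closure_subspaceW. Qed.

End Relative.

Section Continua.
Variable X : topologicalType.

Definition metrizable (R : realType) : Prop :=
  exists d : X -> X -> R,
    [/\ forall x y, d x y = 0 <-> x = y,
        forall x y, d x y = d y x,
        forall x y z, d x z <= d x y + d y z &
        forall (x : X) (A : set X),
          nbhs x A <-> exists2 e : R, 0 < e & [set y | d x y < e] `<=` A].

Definition continuum (K : set X) : Prop := compact K /\ connected K.

Definition indecomposable (K : set X) : Prop :=
  ~ exists A B : set X,
      [/\ continuum A, continuum B, A `<` K, B `<` K & K = A `|` B].

Definition hereditarily_indecomposable (K : set X) : Prop :=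
  forall L : set X, L `<=` K -> continuum L -> indecomposable L.

End Continua.

Section Abbott.
Variable X : topologicalType.

(* The collection C(x, z, Y). *)
Definition conn_nbhd (x z : X) (Y V : set X) : Prop :=
  [/\ open_in Y V, connected V, V x & V z].

(* C is a line of sight, in Y and with respect to K, from z to x.  Meant for
   K `<=` Y `\ z and x in K, so that x and z are distinct. *)
Definition line_of_sight (Y K : set X) (z x : X) (C : set X) : Prop :=
  [/\ C `<=` Y, continuum C, C x /\ C z,
      forall O, open_in Y O -> C `<=` O ->
        exists2 V, conn_nbhd x z Y V & C `<=` V /\ V `<=` O &
      forall U, open_in K U -> U x ->
        exists V, [/\ conn_nbhd x z Y V, C `<=` V,
          V `&` K `<=` closure_in Y V `&` K &
          closure_in Y V `&` K `<=` U]].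

(* The collections X_n. *)
Fixpoint abbott_level (n : nat) : set (set X) :=
  if n is m.+1 then
    [set Y | exists K : set X,
      [/\ K !=set0, abbott_level m K, K `<=` Y &
          exists2 z : X, (Y `\` K) z &
          forall x, K x -> exists W : set X,
            line_of_sight Y K z x W /\
            exists V : set X,
              [/\ conn_nbhd x z Y V, W `<=` V &
                  forall V', conn_nbhd x z Y V' -> W `<=` V' -> V' `<=` V ->
                    exists2 D, D `<=` boundary_in Y V' & abbott_level m D]]]
  else setT.

End Abbott.

Arguments abbott_level : clear implicits.

Definition greatest_abbott_level (X : topologicalType) (n : nat) : Prop :=
  abbott_level X n !=set0 /\
  forall m, abbott_level X m !=set0 -> (m <= n)%N.

(* The dimension ranges over -1, 0, 1, ... and +oo, here inside [\bar int].
   The last case is the one where all levels are nonempty: see Ab_pinfty. *)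
Definition Ab (X : topologicalType) : \bar int :=
  if pselect ([set: X] = set0) then (-1)%:E
  else if pselect (exists n, greatest_abbott_level X n) is left e
       then (Posz (projT1 (cid e)))%:E
       else +oo%E.

Section AbTheory.
Variable X : topologicalType.

Lemma Ab_empty : [set: X] = set0 -> Ab X = (-1)%:E.
Proof. by rewrite /Ab; case: pselect. Qed.

Lemma Ab_fin (n : nat) : [set: X] !=set0 ->
  Ab X = (Posz n)%:E <-> greatest_abbott_level X n.
Proof.
move=> /set0P/eqP X0; rewrite /Ab; case: pselect => //= _.
case: pselect => [e|ne]; last first.
  by split=> // gn; case: ne; exists n.
case: cid => m /= [m0 mmax]; split=> [[<-]//|[n0 nmax]].
by congr (_%:E); congr Posz; apply/eqP; rewrite eqn_leq mmax ?nmax.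
Qed.

Lemma abbott_level_le (m n : nat) : (m <= n)%N ->
  abbott_level X n !=set0 -> abbott_level X m !=set0.
Proof.
elim: n => [|n IHn]; first by rewrite leqn0 => /eqP->.
rewrite leq_eqVlt => /predU1P[->//|]; rewrite ltnS => /IHn{}IHn.
by case=> Y [K [_ levelK _ _]]; apply: IHn; exists K.
Qed.

Lemma Ab_pinfty : [set: X] !=set0 ->
  Ab X = +oo%E <-> forall n, abbott_level X n !=set0.
Proof.
move=> /set0P/eqP X0; rewrite /Ab; case: pselect => //= _.
case: pselect => [e|ne]; split=> // H; last first.
  elim=> [|n [Y levelY]]; first by exists setT.
  apply: contrapT => nlevel; apply: ne; exists n; split; first by exists Y.
  by move=> m; rewrite leqNgt => lm; apply/negP => /abbott_level_le/(_ lm).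
by case: cid => n /= [_ /(_ n.+1 (H n.+1))]; rewrite ltnn.
Qed.

End AbTheory.

(* Main.v *)
Require Import Defs.
From HB Require Import structures.
From mathcomp Require Import all_boot all_order all_algebra.
From mathcomp Require Import all_classical all_reals.
From mathcomp Require Import topology.

Local Open Scope classical_set_scope.
Local Open Scope ring_scope.

(** Two intersecting subcontinua of a hereditarily indecomposable continuum are
    nested, whereas a line of sight with respect to [K] from [z] to [x] meets
    [K] only in [x].  A member [K] of the first Abbott level contains a
    nondegenerate continuum [C]; if [x] is in [C] and [z] is outside [K], a line
    of sight from [z] to [x] would contain [C], so the second level is empty.
    In the first level, the whole continuum is a line of sight between any two
    of its points [z], [x] with respect to [[set x]]. *)

Lemma continuumU {X : topologicalType} {A B : set X} :
  continuum A -> continuum B -> A `&` B !=set0 -> continuum (A `|` B).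
Proof.
move=> [cA kA] [cB kB] AB; split; first exact: compactU.
exact: connectedU.
Qed.

(** If neither contained the other, [A] and [B] would be proper subcontinua decomposing the
    continuum [A] ∪ [B]. *)
Lemma hereditarily_indecomposable_nested {X : topologicalType} {K A B : set X} :
  hereditarily_indecomposable K -> A `<=` K -> B `<=` K ->
  continuum A -> continuum B -> A `&` B !=set0 -> A `<=` B \/ B `<=` A.
Proof.
move=> hiK AK BK cA cB AB; apply: contrapT => /not_orP[nAB nBA].
have ABK : A `|` B `<=` K by rewrite subUset.
have [] := hiK _ ABK (continuumU cA cB AB); exists A, B; split => //.
- by split; [exact: subsetUl | move=> /(subset_trans (@subsetUr _ A B))].
- by split; [exact: subsetUr | move=> /(subset_trans (@subsetUl _ A B))].
Qed.

Lemma line_of_sight_meet {X : topologicalType} {Y K : set X} {z x : X}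
    {C : set X} :
  hausdorff_space X -> line_of_sight Y K z x C -> K x -> C `&` K `<=` [set x].
Proof.
move=> hausX [_ _ _ _ sight] Kx y [Cy Ky]; apply: contrapT => yx.
(* Points are closed, so deleting [y] from [K] leaves a relatively open set around [x]. *)
have [||V [_ CV VK VU]] := sight (K `&` ~` [set y]).
- apply/open_inP; exists (~` [set y]) => //; apply: closed_openC.
  exact: accessible_closed_set1 (hausdorff_accessible hausX) y.
- by split => // xy; apply: yx.
by have [_ /(_ erefl)] := VU _ (VK _ (conj (CV _ Cy) Ky)).
Qed.

(** Any line of sight serves as [C]: its endpoints differ, since [x] lies in [K] and [z] does
    not. *)
Lemma abbott_level1_continuum {X : topologicalType} {Y : set X} :
  abbott_level X 1 Y ->
  exists C x y, [/\ continuum C, C `<=` Y, C x, C y & x <> y].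
Proof.
move=> [K [[x Kx] _ KY [z [Yz nKz] /(_ x Kx)[W [[WY cW [Wx Wz] _ _] _]]]]].
by exists W, x, z; split => // xz; apply: nKz; rewrite -xz.
Qed.

Lemma abbott_level1_setT {X : topologicalType} {x z : X} :
  continuum [set: X] -> x <> z -> abbott_level X 1 [set: X].
Proof.
move=> cX xz; exists [set x]; split => //; first by exists x.
exists z; first by split => // zx; apply: xz.
move=> _ ->; exists setT.
have nbhdT : conn_nbhd x z [set: X] [set: X].
  split => //; first by apply/open_inP; exists setT; rewrite ?setIT //; exact: openT.
  by case: cX.
(* Level 0 contains every set, so the empty set is an admissible [D] in any boundary. *)
split; last by exists setT; split => // V' _ _ _; exists set0.
split => // [O _ TO|U _ Ux]; first by exists setT.
(* As [K] is the singleton of [x], even the whole space meets [K] inside [U]. *)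
exists setT; split => //; last by move=> _ [_ ->].
by move=> y [_ xy]; split => //; exact: subset_closure.
Qed.

Lemma hereditarily_indecomposable_abbott_level2 {X : topologicalType} :
  hausdorff_space X -> hereditarily_indecomposable [set: X] ->
  abbott_level X 2 = set0.
Proof.
move=> hausX hiX; apply/eqP/negPn/negP => /set0P[Y].
move=> [K [_ /abbott_level1_continuum[C [x [y [cC CK Cx Cy xy]]]] _]].
move=> [z [_ nKz] /(_ x (CK _ Cx))[W [losW _]]].
have [_ cW [Wx Wz] _ _] := losW.
have CWx : C `&` W !=set0 by exists x.
(* The case [WC] would put [z] in [K]. *)
have [CW|WC] := hereditarily_indecomposable_nested hiX
    (@subsetT _ C) (@subsetT _ W) cC cW CWx; last by apply/nKz/CK/WC.
have /= yx :=
  line_of_sight_meet hausX losW (CK _ Cx) y (conj (CW _ Cy) (CK _ Cy)).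
exact: xy (esym yx).
Qed.

Theorem theorem4p4 (R : realType) (X : topologicalType)
    (hausX : hausdorff_space X) (metX : metrizable X R)
    (contX : continuum [set: X])
    (hiX : hereditarily_indecomposable [set: X]) :
  (Ab X <= 1%:E)%E /\ (Ab X = 0%:E <-> exists p : X, [set: X] = [set p]).
Proof.
have le1 n : abbott_level X n !=set0 -> (n <= 1)%N.
  rewrite leqNgt => levn; apply/negP => /abbott_level_le/(_ levn)[Y].
  by rewrite hereditarily_indecomposable_abbott_level2.
have [X0|/eqP/set0P[p _]] := pselect ([set: X] = set0).
  (* For the empty space the dimension is -1, and both sides of the equivalence fail. *)
  rewrite Ab_empty //; split; first by rewrite lee_fin.
  by split=> // -[p /seteqP[_ /(_ p erefl)]]; rewrite X0.
have XN0 : [set: X] !=set0 by exists p.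
have [[q [_ qp]]|sing] := pselect (exists q, [set: X] q /\ q <> p).
  have -> : Ab X = 1%:E.
    apply/(@Ab_fin X 1%N XN0); split=> //.
    by exists setT; exact: abbott_level1_setT contX qp.
  split=> //; split=> // -[r Xr]; case: qp.
  have : [set r] q by rewrite -Xr.
  have : [set r] p by rewrite -Xr.
  by move=> -> ->.
have eqp q : q = p by apply: contrapT => qp; apply: sing; exists q.
have -> : Ab X = 0%:E.
  apply/(@Ab_fin X 0%N XN0); split=> [|[//|m]]; first by exists setT.
  (* A nonempty positive level makes level 1 nonempty, which requires two distinct points. *)
  move/(abbott_level_le (ltn0Sn m)) => [Y /abbott_level1_continuum].
  by move=> [C [x [y [_ _ _ _]]]]; rewrite (eqp x) (eqp y).
split; first by rewrite lee_fin.
by split=> // _; exists p; apply/seteqP; split=> q //= _; exact: eqp.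
Qed.
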